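(* Fix constants $\alpha>0$, $\beta>0$, $\gamma_P>2$ and $0<\epsilon<\epsilon_s$, and suppose $$\eta:=\max\{1+(\epsilon-\epsilon_s)/2,\ \epsilon_s\}<1.$$ Let $f_\eta(n):=n^\eta$, $s:=\min\{\lceil\alpha n^{\epsilon_s}\rceil,n-1\}$ and $g:=(\beta s n^{\epsilon})^{1/2}$, and suppose $s<n-1$. Let $c_{nk}$ be the number of comparisons made by the nonrecursive SELECT on an input list of size $n$ with rank $k$, and set $$\hat\gamma_P:=(4\gamma_P+2)(\beta/\alpha)^{1/2}+(2\gamma_P-1)\big[\alpha+1/f_\eta(n)\big].$$ Then $$\mathrm{P}\big[c_{nk}\le n+\min\{k,n-k\}+\hat\gamma_P f_\eta(n)\big]\ge1-4e^{-2\beta n^{\epsilon}}.$$ Moreover, if $n^{1-\eta}e^{-2\beta n^{\epsilon}}\le1$, then $$\mathrm{E}\,c_{nk}\le n+\min\{k,n-k\}+(\hat\gamma_P+4\gamma_P+2)f_\eta(n).$$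
   Context: Nonrecursive SELECT. The input is a list $X=(x_1,\dots,x_n)$ of elements of a totally ordered set (repeated values allowed) and an integer $1\le k\le n$. Let $\mathcal R$ be a deterministic routine that finds the $i$th smallest of any $m$ elements using at most $\gamma_P m$ comparisons. 1. Choose a set $I$ of $s$ positions uniformly at random among all $s$-subsets of $\{1,\dots,n\}$. The sample is $S=(x_j)_{j\in I}$ with sorted elements $y_1^*\le\dots\le y_s^*$. 2. Set $i_u:=\max\{\lceil ks/n-g\rceil,1\}$ and $i_v:=\min\{\lceil ks/n+g\rceil,s\}$. Compute $u:=y_{i_u}^*$ and $v:=y_{i_v}^*$ using $\mathcal R$ at most twice on at most $s$ elements, so this step uses at most $2\gamma_P s$ comparisons. 3. Partition. Each $x_j$ with $j\notin I$ is compared with the pivots. - If $k<n/2$: $x_j$ is compared with $v$ first, and with $u$ only if $x_j<v$ and $u<v$. - If $k\ge n/2$: $x_j$ is compared with $u$ first, and with $v$ only if $x_j>u$ and $u<v$. Sample elements are not compared. Hence this step uses $c$ comparisons, where $c=n-s$ if $u=v$, $c=(n-s)+|\{j\notin I:x_j<v\}|$ if $u<v$ and $k<n/2$, and $c=(n-s)+|\{j\notin I:x_j>u\}|$ if $u<v$ and $k\ge n/2$. 4. Let $L=\{x<u\}$, $U=\{x=u\}$, $M=\{u<x<v\}$ and $R=\{x>v\}$. - If $|L|<k\le|L\cup U|$, return $u$; if $|L\cup U\cup M|<k\le n-|R|$, return $v$. In either case set $\hat n:=0$. - Otherwise let $\hat X$ be $L$ if $k\le|L|$, else $R$ if $n-|R|<k$,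 else $M$. Let $\hat n:=|\hat X|$ and find the answer in $\hat X$ with $\mathcal R$, using at most $\gamma_P\hat n$ comparisons. The total count $c_{nk}$ consists of the comparisons in steps 2, 3 and 4, so $c_{nk}\le 2\gamma_P s+c+\gamma_P\hat n$. $\mathrm{P}$ and $\mathrm{E}$ are with respect to the random sample. *)

(* Defs.v *)
From HB Require Import structures.
From mathcomp Require Import all_boot all_order all_algebra.
From mathcomp Require Import reals sequences exp.
Set Implicit Arguments. Unset Strict Implicit. Unset Printing Implicit Defensive.
Import Order.TTheory GRing.Theory Num.Theory.
Local Open Scope ring_scope.

Section Select.
Variables (R : realType) (d : Order.disp_t) (T : orderType d).

Definition eta_of (eps eps_s : R) : R := Num.max (1 + (eps - eps_s) / 2) eps_s.

Definition sample_size (alpha eps_s : R) (n : nat) : nat :=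
  minn `|Num.ceil (alpha * n%:R `^ eps_s)|%N n.-1.

Definition gap (beta eps : R) (n s : nat) : R :=
  Num.sqrt (beta * s%:R * n%:R `^ eps).

(* i_u := max{ ceil(ks/n - g), 1 },  i_v := min{ ceil(ks/n + g), s } (1-based) *)
Definition idx_u (n k s : nat) (g : R) : nat :=
  `|Num.max (Num.ceil (k%:R * s%:R / n%:R - g)) 1|%N.
Definition idx_v (n k s : nat) (g : R) : nat :=
  `|Num.min (Num.ceil (k%:R * s%:R / n%:R + g)) (s%:Z)|%N.

(* i-th smallest (1-based) of the sample (x_j)_{j in I};
   x0 is an irrelevant default value for out-of-range indices *)
Definition order_stat (n : nat) (x0 : T) (X : 'I_n -> T) (I : {set 'I_n}) (i : nat) : T :=
  nth x0 (sort <=%O [seq X j | j <- enum I]) i.-1.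

Definition partition_cost (n k : nat) (X : 'I_n -> T) (I : {set 'I_n}) (u v : T) : nat :=
  (n - #|I|) +
  (if (u < v)%O then
     (if (2 * k < n)%N then #|[set j | (j \notin I) && (X j < v)%O]|
      else #|[set j | (j \notin I) && (u < X j)%O]|)
   else 0).

Definition nhat (n k : nat) (X : 'I_n -> T) (u v : T) : nat :=
  let cL := #|[set j | (X j < u)%O]| in
  let cU := #|[set j | X j == u]| in
  let cM := #|[set j | (u < X j)%O && (X j < v)%O]| in
  let cR := #|[set j | (v < X j)%O]| in
  if ((cL < k) && (k <= cL + cU))%N || ((cL + cU + cM < k) && (k <= n - cR))%N then 0%N
  else if (k <= cL)%N then cL
  else if (n - cR < k)%N then cR
  else cM.

Definition prob (n s : nat) (A : pred {set 'I_n}) : R :=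
  #|[set I : {set 'I_n} | (#|I| == s) && A I]|%:R / 'C(n, s)%:R.

Definition expect (n s : nat) (F : {set 'I_n} -> R) : R :=
  (\sum_(I : {set 'I_n} | #|I| == s) F I) / 'C(n, s)%:R.

End Select.

(* Main.v *)
Require Import Defs.
From HB Require Import structures.
From mathcomp Require Import all_boot all_order all_algebra.
From mathcomp Require Import reals normedtype sequences derive realfun exp.
From mathcomp Require Import ring lra zify.
Import Order.TTheory GRing.Theory Num.Theory.
Import numFieldNormedType.Exports.
Local Open Scope ring_scope.

(**
For a fixed set A of positions, the number of sampled positions in A is
hypergeometric. Expanding (1 + w)^#|I :&: A| over the subsets of I :&: A shows
that its moment generating function is at most the binomial one, so Hoeffding's
bound exp(-2 g^2 / s) holds for both tails.

Let W = g n / s. Taking for A the m smallest positions (ties broken arbitrarily),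
for suitable m, each of the following events has probability at most
exp(-2 g^2 / s) = exp(-2 beta n^eps): u exceeds the k-th smallest input, the rank
of u is at most k - 2 W, v is below the k-th smallest input, the rank of v is at
least k + 2 W. Outside of them the partitioning costs at most
n - s + min(k, n - k) + 2 W comparisons and the remaining list has at most 4 W
elements, while W <= sqrt(beta / alpha) n^eta. The tail bound is the union bound;
the expectation bound charges n for each failure and uses
n exp(-2 beta n^eps) <= n^eta.
*)

(** * Hoeffding's bound for one Bernoulli variable *)

Section Hoeffding.
Set Implicit Arguments. Unset Strict Implicit.
Variable R : realType.
Implicit Types (p t w : R).

Lemma is_derive_ge0_le (f f' : R -> R) t :
    (forall x : R, is_derive x 1 f (f' x)) -> (forall x, 0 <= x -> 0 <= f' x) ->
  0 <= t -> f 0 <= f t.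
Proof.
move=> df f'0 t0.
have dd x : derivable f x 1 by apply: (@ex_derive _ _ _ _ _ _ _ (df x)).
apply: (@ger0_derive1_le_cc R f 0 t) => //; rewrite ?in_itv /= ?lexx ?t0 //.
- move=> x; rewrite in_itv /= => /andP[x0 _].
  by rewrite derive1E (@derive_val _ _ _ _ _ _ _ (df x)) f'0 // ltW.
- by apply: derivable_within_continuous => x _.
Qed.

(* The slope [q = p e^t / (1 - p + p e^t)] of [ln (1 - p + p e^t)] satisfies
   [q' = q (1 - q) <= 1/4]. *)
Lemma bernoulli_tilt_le p t : 0 <= p <= 1 -> 0 <= t ->
  p * expR t <= (p + t / 4) * (1 - p + p * expR t).
Proof.
move=> /andP[p0 p1] t0.
pose D (x : R) : R := 1 - p + p * expR x.
have D0 x : 0 < D x.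
  have := expR_gt0 x; rewrite /D => ex.
  have [->|pN] := eqVneq p 0; first by rewrite mul0r; lra.
  by apply: ltr_wpDl; [lra | rewrite mulr_gt0 // lt_neqAle eq_sym pN].
have dD (x : R) : is_derive x 1 D (p * expR x).
  rewrite /D; apply: is_derive_eq.
  rewrite /GRing.scale /=; ring.
(* Since [q = 1 - (1 - p) / D], this function is [p + y / 4 - q], which vanishes at 0. Its
   derivative is nonnegative because [D^2 / 4 - (1 - p) (D - (1 - p))] is the square of
   [D / 2 - (1 - p)]. *)
have dV (x : R) : is_derive x 1 (fun y => p + y / 4 - 1 + (1 - p) * (D y)^-1)
    (4^-1 - (1 - p) * (p * expR x) / D x ^+ 2).
  have := @is_deriveV R D x _ 1 (lt0r_neq0 (D0 x)) (dD x).
  move=> h; apply: is_derive_eq.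
  rewrite /GRing.scale /=.
  by have := lt0r_neq0 (D0 x) => ?; field.
have := @is_derive_ge0_le _ _ t dV _ t0.
have -> : D 0 = 1 by rewrite /D expR0; ring.
rewrite invr1 mulr1 mul0r addr0.
have -> : p - 1 + (1 - p) = 0 by ring.
move=> h; have {h} : 0 <= p + t / 4 - 1 + (1 - p) / D t.
  apply: h => x x0; rewrite subr_ge0 ler_pdivrMr ?exprn_gt0 //.
  have -> : p * expR x = D x - (1 - p) by rewrite /D; ring.
  by rewrite -subr_ge0; have := sqr_ge0 (D x / 2 - (1 - p)); nra.
rewrite -(pmulr_lge0 _ (D0 t)) mulrDl divfK ?lt0r_neq0 // -[X in _ -> is_true X]subr_ge0.
by rewrite /D; set e := expR t; lra.
Qed.

(** The quotient [D * E] of the two sides is 1 at 0, and [bernoulli_tilt_le] makes its derivative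
    nonpositive for [t >= 0]. *)
Lemma hoeffding_bernoulli p t : 0 <= p <= 1 -> 0 <= t ->
  1 - p + p * expR t <= expR (t * p + t ^+ 2 / 8).
Proof.
move=> p01 t0.
pose D (x : R) : R := 1 - p + p * expR x; pose E (x : R) : R := expR (- (x * p + x ^+ 2 / 8)).
have dD (x : R) : is_derive x 1 D (p * expR x).
  rewrite /D; apply: is_derive_eq.
  rewrite /GRing.scale /=; ring.
have dE (x : R) : is_derive x 1 E (- (p + x / 4) * E x).
  rewrite /E; apply: is_derive_eq.
  by rewrite /GRing.scale /=; field.
have dF (x : R) : is_derive x 1 (fun y => - (D y * E y))
    (E x * ((p + x / 4) * D x - p * expR x)).
  apply: is_derive_eq; rewrite /GRing.scale /=; ring.
have := @is_derive_ge0_le _ _ t dF _ t0.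
have -> : D 0 * E 0 = 1.
  by rewrite /D /E !mul0r expr0n mul0r addr0 oppr0 !expR0; ring.
move=> h; have {h} : -1 <= - (D t * E t).
  apply: h => x x0; apply: mulr_ge0; first exact: expR_ge0.
  by rewrite subr_ge0; apply: bernoulli_tilt_le.
by rewrite lerN2 /E expRN ler_pdivrMr ?expR_gt0 // mul1r.
Qed.

End Hoeffding.

(** * Tails of the hypergeometric distribution *)

Section Hypergeometric.
Set Implicit Arguments. Unset Strict Implicit.
Variable R : realType.

Lemma card_set_ord_le (n : nat) (A : {set 'I_n}) : (#|A| <= n)%N.
Proof. by rewrite -[X in (_ <= X)%N](card_ord n) max_card. Qed.

(** Factor by factor, [(m - i) / (n - i) <= m / n]. *)
Lemma ffact_ratio_le (m n j : nat) : (m <= n)%N -> (n ^ j * m ^_ j <= m ^ j * n ^_ j)%N.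
Proof.
move=> mn; elim: j => [|j IH]; first by rewrite !ffactn0.
rewrite !expnS !ffactnSr.
have h : (n * (m - j) <= m * (n - j))%N by nia.
have := leq_mul IH h; nia.
Qed.

(** Complements of such [I] are the subsets of [~: J] of size [n - s]. The lower index [n - s] makes
    the binomial vanish when [#|J| > s], where [s - #|J|] would truncate to 0. *)
Lemma card_supersets (n s : nat) (J : {set 'I_n}) : (s <= n)%N ->
  #|[set I : {set 'I_n} | (#|I| == s) && (J \subset I)]| = 'C(n - #|J|, n - s).
Proof.
move=> sn; have -> : (n - #|J| = #|~: J|)%N by rewrite [#|~: J|]cardsCs setCK card_ord.
rewrite -cards_draws -(card_imset _ (@setC_inj _)).
apply: eq_card => B; apply/imsetP/idP.
  move=> [I]; rewrite inE => /andP[/eqP cI JI] ->.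
  by rewrite inE setCS JI cardsCs setCK cI card_ord /=.
rewrite inE => /andP[BJ /eqP cB]; exists (~: B); last by rewrite setCK.
by rewrite inE subsetC BJ andbT cardsCs setCK cB card_ord subKn.
Qed.

Lemma bin_trinomial (n s j : nat) : (j <= s <= n)%N ->
  ('C(n, s) * 'C(s, j) = 'C(n, j) * 'C(n - j, n - s))%N.
Proof.
move=> /andP[js sn]; have jn := leq_trans js sn.
have nsj : (n - s <= n - j)%N by lia.
have h1 := bin_fact sn; have h2 := bin_fact js.
have h3 := bin_fact jn; have h4 := bin_fact nsj.
have e : (n - j - (n - s) = s - j)%N by lia.
rewrite e in h4.
apply/eqP; rewrite -(eqn_pmul2r (fact_gt0 j)) -(eqn_pmul2r (fact_gt0 (s - j))).
rewrite -(eqn_pmul2r (fact_gt0 (n - s))); apply/eqP.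
transitivity (n`!)%N; first by rewrite -h1 -h2; ring.
by rewrite -h3 -h4; ring.
Qed.

Lemma sum_subset_card (n : nat) (A : {set 'I_n}) (F : nat -> R) :
  \sum_(J : {set 'I_n} | J \subset A) F #|J| = \sum_(j < n.+1) F j *+ 'C(#|A|, j).
Proof.
rewrite (partition_big (fun J : {set 'I_n} => inord #|J| : 'I_n.+1) xpredT) //=.
apply: eq_bigr => j _; rewrite -cards_draws -sumr_const.
have jE (J : {set 'I_n}) : (inord #|J| == j) = (#|J| == j :> nat).
  by rewrite -val_eqE /= inordK // ltnS card_set_ord_le.
apply: eq_big => [J|J /andP[_]]; first by rewrite inE jE.
by rewrite jE => /eqP ->.
Qed.

(** Expand the power as the sum of [w ^+ #|J|] over [J \subset I :&: A], exchange the sums, and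
    count the samples [I] containing each [J]. *)
Lemma sum_expr_cardI (n s : nat) (A : {set 'I_n}) (w : R) : (s <= n)%N ->
  \sum_(I : {set 'I_n} | #|I| == s) (1 + w) ^+ #|I :&: A| =
  \sum_(j < n.+1) w ^+ j * ('C(#|A|, j) * 'C(n - j, n - s))%:R.
Proof.
move=> sn.
have expand (B : {set 'I_n}) :
    (1 + w) ^+ #|B| = \sum_(J : {set 'I_n} | J \subset B) w ^+ #|J|.
  rewrite (sum_subset_card _ (fun j => w ^+ j)) exprDn.
  under eq_bigr do rewrite expr1n mul1r.
  have cB : (#|B|.+1 <= n.+1)%N by rewrite ltnS card_set_ord_le.
  rewrite (big_ord_widen _ (fun j => w ^+ j *+ 'C(#|B|, j)) cB) big_mkcond /=.
  apply: eq_bigr => j _; case: ifP => // /negbT; rewrite -leqNgt => jB.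
  by rewrite bin_small.
under eq_bigr do rewrite expand.
rewrite (exchange_big_dep (fun J : {set 'I_n} => J \subset A)) /=; last first.
  by move=> I J _; rewrite subsetI => /andP[].
transitivity (\sum_(J : {set 'I_n} | J \subset A) w ^+ #|J| *+ 'C(n - #|J|, n - s)).
  apply: eq_bigr => J JA; rewrite -card_supersets // -sumr_const.
  by apply: eq_bigl => I; rewrite inE subsetI JA andbT.
rewrite (sum_subset_card _ (fun j => w ^+ j *+ 'C(n - j, n - s))).
by apply: eq_bigr => j _; rewrite -mulrnA mulr_natr mulnC.
Qed.

(* The moment generating function without replacement is dominated by the
   binomial one because ['C(m, j) / 'C(n, j) <= (m / n)^j]. *)
Lemma hypergeometric_mgf_le (n s : nat) (A : {set 'I_n}) (w : R) : (0 < n)%N ->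
    (s <= n)%N -> 0 <= w ->
  \sum_(I : {set 'I_n} | #|I| == s) (1 + w) ^+ #|I :&: A|
  <= 'C(n, s)%:R * (1 + #|A|%:R / n%:R * w) ^+ s.
Proof.
move=> n0 sn w0; rewrite sum_expr_cardI // exprDn mulr_sumr.
rewrite (big_ord_widen n.+1 (fun j => 'C(n, s)%:R *
  (1 ^+ (s - j) * (#|A|%:R / n%:R * w) ^+ j *+ 'C(s, j)))) // big_mkcond /=.
rewrite [X in _ <= X]big_mkcond /=.
apply: ler_sum => j _; case: ifP => [js|/negbT]; last first.
  (* For [j > s] the binomial side has no term, and ['C(n - j, n - s) = 0]. *)
  by rewrite -leqNgt => sj; rewrite [X in (_ * X)%N]bin_small ?muln0 ?mulr0 //;
    have := ltn_ord j; lia.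
rewrite expr1n mul1r exprMn -[_ *+ 'C(s, j)]mulr_natl.
have Am := card_set_ord_le A.
have n0R : (0 : R) < n%:R by rewrite ltr0n.
have key : 'C(#|A|, j)%:R <= 'C(n, j)%:R * (#|A|%:R / n%:R) ^+ j :> R.
  rewrite expr_div_n mulrA ler_pdivlMr ?exprn_gt0 // -!natrX -!natrM ler_nat.
  have := @ffact_ratio_le _ _ j Am; rewrite -!bin_ffact => h.
  by rewrite -(leq_pmul2r (fact_gt0 j)); nia.
have bt : 'C(n, s)%:R * 'C(s, j)%:R = 'C(n, j)%:R * 'C(n - j, n - s)%:R :> R.
  by rewrite -!natrM bin_trinomial // sn andbT -ltnS.
have -> : 'C(n, s)%:R * ('C(s, j)%:R * ((#|A|%:R / n%:R) ^+ j * w ^+ j)) =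
   w ^+ j * (('C(n, j)%:R * (#|A|%:R / n%:R) ^+ j) * 'C(n - j, n - s)%:R) :> R.
  by rewrite mulrA bt; ring.
by rewrite ler_wpM2l ?exprn_ge0 // natrM ler_wpM2r ?ler0n.
Qed.

Lemma prob_expect (n s : nat) (P : pred {set 'I_n}) :
  prob R s P = expect s (fun I => (P I)%:R).
Proof.
rewrite /prob /expect; congr (_ / _).
rewrite -sum1_card natr_sum big_mkcond [RHS]big_mkcond /=.
by apply: eq_bigr => I _; rewrite inE; case: (#|I| == s); case: (P I).
Qed.

Lemma ler_expect (n s : nat) (F G : {set 'I_n} -> R) :
  (forall I : {set 'I_n}, #|I| = s -> F I <= G I) -> expect s F <= expect s G.
Proof.
move=> FG; rewrite /expect ler_wpM2r ?invr_ge0 ?ler0n //.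
by apply: ler_sum => I /eqP; apply: FG.
Qed.

Lemma ler_prob (n s : nat) (P Q : pred {set 'I_n}) :
  (forall I : {set 'I_n}, #|I| = s -> P I -> Q I) -> prob R s P <= prob R s Q.
Proof.
move=> PQ; rewrite !prob_expect; apply: ler_expect => I cI; rewrite ler_nat.
by have := PQ I cI; case: (P I) (Q I) => [] [] // ->.
Qed.

Lemma expectD (n s : nat) (F G : {set 'I_n} -> R) :
  expect s (fun I => F I + G I) = expect s F + expect s G.
Proof. by rewrite /expect big_split mulrDl. Qed.

Lemma expectZ (n s : nat) (a : R) (F : {set 'I_n} -> R) :
  expect s (fun I => a * F I) = a * expect s F.
Proof. by rewrite /expect -mulr_sumr mulrA. Qed.

Lemma expect_cst (n s : nat) (a : R) : (s <= n)%N ->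
  expect s (fun _ : {set 'I_n} => a) = a.
Proof.
move=> sn; rewrite /expect.
have -> : \sum_(I : {set 'I_n} | #|I| == s) a = a *+ 'C(n, s).
  rewrite -[in RHS](card_ord n) -card_draws -sumr_const.
  by apply: eq_bigl => I; rewrite inE.
by rewrite -[a *+ _]mulr_natr mulfK // pnatr_eq0 -lt0n bin_gt0.
Qed.

(** Chernoff's method: [F] dominates the indicator of the event. Taking [w = expR t - 1] in
    [hypergeometric_mgf_le] bounds its mean, and [hoeffding_bernoulli] bounds each of the [s]
    factors. *)
Lemma hypergeometric_upper_tail (n s : nat) (A : {set 'I_n}) (g : R) :
    (0 < s <= n)%N -> 0 <= g ->
  prob R s (fun I : {set 'I_n} => s%:R * #|A|%:R / n%:R + g <= #|I :&: A|%:R)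
  <= expR (- (2 * g ^+ 2 / s%:R)).
Proof.
move=> /andP[s0 sn] g0.
have n0 : (0 < n)%N by exact: leq_trans s0 sn.
have s0R : (0 : R) < s%:R by rewrite ltr0n.
have n0R : (0 : R) < n%:R by rewrite ltr0n.
pose p : R := #|A|%:R / n%:R.
have p01 : 0 <= p <= 1.
  rewrite divr_ge0 ?ler0n //= ler_pdivrMr // mul1r ler_nat.
  exact: card_set_ord_le.
(* The exponent [t] minimises [s t^2 / 8 - t g]. *)
pose t := 4 * g / s%:R.
have t0 : 0 <= t by rewrite divr_ge0 ?mulr_ge0 ?ler0n.
have e1 : 0 <= expR t - 1 by rewrite subr_ge0 -expR0 ler_expR.
pose F (I : {set 'I_n}) := expR (- (t * (s%:R * p + g))) * (1 + (expR t - 1)) ^+ #|I :&: A|.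
have FE I : F I = expR (t * #|I :&: A|%:R - t * (s%:R * p + g)).
  by rewrite /F [1 + _]addrC subrK -expRM_natr expRD mulrC.
apply: (@le_trans _ _ (expect s F)).
  rewrite prob_expect; apply: ler_expect => I cI; rewrite FE -mulrBr.
  case: (boolP (_ + g <= _)) => [h|_] /=; last exact: expR_ge0.
  rewrite -[X in X <= _]expR0 ler_expR mulr_ge0 // subr_ge0 /p mulrA.
  exact: h.
have C0 : (0 : R) < 'C(n, s)%:R by rewrite ltr0n bin_gt0.
rewrite /F expectZ /expect.
have mgf := @hypergeometric_mgf_le n s A _ n0 sn e1.
have hb : 1 + p * (expR t - 1) <= expR (t * p + t ^+ 2 / 8).
  by have := @hoeffding_bernoulli R p t p01 t0; lra.
have pe : 0 <= 1 + p * (expR t - 1).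
  by case/andP: p01 => p0 _; rewrite addr_ge0 // mulr_ge0.
have : (1 + p * (expR t - 1)) ^+ s <= expR (s%:R * (t * p + t ^+ 2 / 8)).
  by rewrite [s%:R * _]mulrC expRM_natr lerXn2r ?nnegrE ?expR_ge0 //.
set M := _ ^+ s => hM.
apply: (@le_trans _ _ (expR (- (t * (s%:R * p + g))) * M)).
  by rewrite ler_wpM2l ?expR_ge0 // ler_pdivrMr // mulrC.
apply: (@le_trans _ _ (expR (- (t * (s%:R * p + g))) * expR (s%:R * (t * p + t ^+ 2 / 8)))).
  by rewrite ler_wpM2l ?expR_ge0.
rewrite -expRD ler_expR le_eqVlt; apply/orP; left; apply/eqP.
by rewrite /t; have := lt0r_neq0 s0R => ?; field.
Qed.

(** Few hits in [A] are many hits in [~: A]. *)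
Lemma hypergeometric_lower_tail (n s : nat) (A : {set 'I_n}) (g : R) :
    (0 < s <= n)%N -> 0 <= g ->
  prob R s (fun I : {set 'I_n} => #|I :&: A|%:R <= s%:R * #|A|%:R / n%:R - g)
  <= expR (- (2 * g ^+ 2 / s%:R)).
Proof.
move=> /[dup] s0n /andP[s0 sn] g0.
apply: le_trans (@hypergeometric_upper_tail n s (~: A) g s0n g0).
apply: ler_prob => I cI /=.
have n0 : (0 : R) < n%:R by rewrite ltr0n (leq_trans s0 sn).
have -> : #|~: A|%:R = n%:R - #|A|%:R :> R.
  by apply/eqP; rewrite eq_sym subr_eq -natrD addnC cardsC card_ord.
have -> : #|I :&: ~: A|%:R = s%:R - #|I :&: A|%:R :> R.
  by rewrite -setDE -cI -(cardsID A I) natrD addrAC subrr add0r.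
have -> : s%:R * (n%:R - #|A|%:R) / n%:R = s%:R - s%:R * #|A|%:R / n%:R :> R.
  by have := lt0r_neq0 n0 => ?; field.
by lra.
Qed.

End Hypergeometric.

(** * Ranks of sample order statistics in the whole input *)

Section OrderStatistics.
Set Implicit Arguments. Unset Strict Implicit.
Variables (R : realType) (d : Order.disp_t) (T : orderType d) (n : nat).
Variables (X : 'I_n -> T) (x0 : T).
Implicit Types (I A D : {set 'I_n}).

Lemma count_sorted_sample I (P : pred T) :
  count P (sort <=%O [seq X j | j <- enum I]) = #|I :&: [set j | P (X j)]|.
Proof.
rewrite (permP (permEl (perm_sort _ _))) count_map -sum1_count big_enum_cond /=.
by rewrite -sum1_card; apply: eq_bigl => j; rewrite !inE.
Qed.

Lemma size_sorted_sample I : size (sort <=%O [seq X j | j <- enum I]) = #|I|.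
Proof. by rewrite size_sort size_map -cardE. Qed.

Lemma order_stat_le I i j : (i <= j <= #|I|)%N -> (0 < i)%N ->
  (order_stat x0 X I i <= order_stat x0 X I j)%O.
Proof.
move=> /andP[ij jI] i0; rewrite /order_stat.
apply: (@sorted_leq_nth _ _ le_trans lexx) => //; rewrite ?inE ?size_sorted_sample; try lia.
Qed.

(** The first [i] entries of the sorted sample qualify; ties can only add more. *)
Lemma order_stat_card_le I i : (0 < i <= #|I|)%N ->
  (i <= #|I :&: [set j | (X j <= order_stat x0 X I i)%O]|)%N.
Proof.
move=> /andP[i0 iI]; rewrite -(count_sorted_sample I (fun x => x <= _)%O) /order_stat.
set t := sort _ _; have st : size t = #|I| by exact: size_sorted_sample.
rewrite -{2}(cat_take_drop i t) count_cat.
have : all (fun x => x <= nth x0 t i.-1)%O (take i t).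
  apply/(all_nthP x0) => j; rewrite size_take st => ji.
  have {}ji : (j < i)%N by move: ji; case: ifP => //; lia.
  rewrite nth_take //.
  apply: (@sorted_leq_nth _ _ le_trans lexx) => //; rewrite ?inE ?st; try lia.
  exact: sort_le_sorted.
by rewrite all_count size_takel ?st // => /eqP ->; rewrite leq_addr.
Qed.

Lemma order_stat_card_lt I i : (0 < i <= #|I|)%N ->
  (#|I :&: [set j | (X j < order_stat x0 X I i)%O]| < i)%N.
Proof.
move=> /andP[i0 iI]; rewrite -(count_sorted_sample I (fun x => x < _)%O) /order_stat.
set t := sort _ _; have st : size t = #|I| by exact: size_sorted_sample.
rewrite -{2}(cat_take_drop i.-1 t) count_cat.
have : ~~ has (fun x => x < nth x0 t i.-1)%O (drop i.-1 t).
  rewrite -all_predC; apply/(all_nthP x0) => j; rewrite size_drop st => ji /=.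
  rewrite nth_drop -leNgt.
  apply: (@sorted_leq_nth _ _ le_trans lexx) => //; rewrite ?inE ?st; try lia.
  exact: sort_le_sorted.
rewrite has_count -leqNgt leqn0 => /eqP ->; rewrite addn0.
by apply: (leq_ltn_trans (count_size _ _)); rewrite size_takel ?st; lia.
Qed.

(** With repeated values a set [X j <= y] cannot have every cardinality. Sorting positions instead
    of values gives a set of any prescribed size, fixed before the sample is drawn. *)
Lemma exists_smallest_set (m : nat) : (m <= n)%N ->
  exists2 A : {set 'I_n}, #|A| = m & forall i j, i \in A -> j \notin A -> (X i <= X j)%O.
Proof.
move=> mn; pose leX := relpre X <=%O.
have tX : total leX by move=> i j; exact: le_total.
have trX : transitive leX by move=> j i l; exact: le_trans.
pose t := sort leX (enum 'I_n).
have ut : uniq t by rewrite sort_uniq enum_uniq.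
have st : size t = n by rewrite size_sort size_enum_ord.
exists [set j in take m t].
  by rewrite cardsE (card_uniqP (take_uniq m ut)) size_takel // st.
move=> i j; rewrite !inE => it jt.
have {}jt : j \in drop m t.
  have : j \in t by rewrite mem_sort mem_enum.
  by rewrite -{1}(cat_take_drop m t) mem_cat (negbTE jt).
have : sorted leX t by apply: sort_sorted.
rewrite -(cat_take_drop m t) (sorted_pairwise trX) pairwise_cat => /andP[/allrelP h _].
exact: h.
Qed.

(** If [i] were in [A] but not [D], and [j] in [D] but not [A], then [X i <= X j < X i]. The strict
    inequality for [D] is what makes ties harmless. *)
Lemma smallest_set_sub_downset A D :
    (forall i j, i \in A -> j \notin A -> (X i <= X j)%O) ->
    (forall i j, i \in D -> j \notin D -> (X i < X j)%O) ->
  (#|A| <= #|D|)%N -> A \subset D.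
Proof.
move=> hA hD AD; apply/negP => /negP/subsetPn[i iA iD].
have /subsetPn[j jD jA] : ~~ (D \subset A).
  apply/negP => DA; have /eqP DE : D == A by rewrite eqEcard DA.
  by rewrite DE iA in iD.
by have := hA i j iA jA; rewrite leNgt hD.
Qed.

Lemma downset_sub_smallest_set A D :
    (forall i j, i \in A -> j \notin A -> (X i <= X j)%O) ->
    (forall i j, i \in D -> j \notin D -> (X i < X j)%O) ->
  (#|D| <= #|A|)%N -> D \subset A.
Proof.
move=> hA hD DA; apply/negP => /negP/subsetPn[j jD jA].
have /subsetPn[i iA iD] : ~~ (A \subset D).
  apply/negP => AD; have /eqP AE : A == D by rewrite eqEcard AD.
  by rewrite AE jD in jA.
by have := hA i j iA jA; rewrite leNgt hD.
Qed.

Lemma downset_lt y i j : i \in [set j | (X j < y)%O] -> j \notin [set j | (X j < y)%O] ->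
  (X i < X j)%O.
Proof. by rewrite !inE -leNgt; exact: lt_le_trans. Qed.

Lemma downset_le y i j : i \in [set j | (X j <= y)%O] -> j \notin [set j | (X j <= y)%O] ->
  (X i < X j)%O.
Proof. by rewrite !inE -ltNge; exact: le_lt_trans. Qed.

Lemma prob_false (s : nat) (P : pred {set 'I_n}) : (forall I, P I = false) ->
  prob R s P = 0.
Proof.
move=> P0; rewrite /prob (_ : [set _ | _] = set0) ?cards0 ?mul0r //.
by apply/setP => I; rewrite !inE P0 andbF.
Qed.

(** Let [A] consist of [m] smallest positions, [m] being the least natural number with [r <= m]. On
    the event, [A] lies strictly below the order statistic, so it contains at most [i - 1] sampled
    positions: a lower-tail deviation of at least [g]. *)
Lemma prob_order_stat_high (s i : nat) (r g : R) :
    (0 < i <= s)%N -> (s <= n)%N -> 0 <= g -> i%:R - 1 <= r * s%:R / n%:R - g ->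
  prob R s (fun I => r <= #|[set j | (X j < order_stat x0 X I i)%O]|%:R)
  <= expR (- (2 * g ^+ 2 / s%:R)).
Proof.
move=> /andP[i0 iS] sn g0 hi.
have s0 : (0 < s)%N by exact: leq_trans iS.
have n0 : (0 : R) < n%:R by rewrite ltr0n (leq_trans s0).
have exP : exists m : nat, r <= m%:R.
  exists `|Num.ceil r|%N; rewrite natr_absz.
  by apply: le_trans (ceil_ge r) _; rewrite ler_int ler_norm.
case: (ex_minnP exP) => m rm minm.
have [mn|nm] := leqP m n; last first.
  rewrite prob_false ?expR_ge0 // => I; apply/negP => /minm.
  by apply/negP; rewrite -ltnNge (leq_ltn_trans (card_set_ord_le _)).
have [A cA hA] := exists_smallest_set mn.
apply: le_trans (@hypergeometric_lower_tail R n s A g _ g0); last by rewrite s0.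
apply: ler_prob => I cI /minm mD; rewrite cA.
have AD := smallest_set_sub_downset hA (@downset_lt (order_stat x0 X I i)).
have {}AD := AD (leq_trans (eq_leq cA) mD).
have h1 : (#|I :&: A| < i)%N.
  apply: leq_ltn_trans (subset_leq_card (setIS I AD)) _.
  by apply: order_stat_card_lt; rewrite cI i0.
have h2 : #|I :&: A|%:R + 1 <= i%:R :> R by rewrite natr1 ler_nat.
have h3 : r * s%:R / n%:R <= s%:R * m%:R / n%:R.
  by rewrite ler_pM2r ?invr_gt0 // mulrC ler_wpM2l ?ler0n.
lra.
Qed.

(** Dually, [m] is the largest natural number below [r] and [n]. On the event, the positions up to
    the order statistic lie in [A], which thus receives at least [i] sampled positions. *)
Lemma prob_order_stat_low (s i : nat) (r g : R) :
    (0 < i <= s)%N -> (s <= n)%N -> 0 <= g -> r * s%:R / n%:R + g <= i%:R ->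
  prob R s (fun I => #|[set j | (X j <= order_stat x0 X I i)%O]|%:R <= r)
  <= expR (- (2 * g ^+ 2 / s%:R)).
Proof.
move=> /andP[i0 iS] sn g0 hi.
have s0 : (0 < s)%N by exact: leq_trans iS.
have n0 : (0 : R) < n%:R by rewrite ltr0n (leq_trans s0).
have [r0|r0] := ltP r 0.
  rewrite prob_false ?expR_ge0 // => I; apply/negP => h.
  by have := le_lt_trans h r0; rewrite ltrn0.
pose P (m : nat) := (m%:R <= r) && (m <= n)%N.
have exP : exists m, P m by exists 0%N; rewrite /P r0.
have ubP m : P m -> (m <= n)%N by case/andP.
case: (ex_maxnP exP ubP) => m /andP[mr mn] maxm.
have [A cA hA] := exists_smallest_set mn.
apply: le_trans (@hypergeometric_upper_tail R n s A g _ g0); last by rewrite s0.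
apply: ler_prob => I cI rD; rewrite cA.
have mD := maxm _ (introT andP (conj rD (card_set_ord_le _))).
have DA := downset_sub_smallest_set hA (@downset_le (order_stat x0 X I i)).
have {}DA := DA (leq_trans mD (eq_leq (esym cA))).
have h1 : (i <= #|I :&: A|)%N.
  apply: leq_trans (subset_leq_card (setIS I DA)).
  by apply: order_stat_card_le; rewrite cI i0.
have h2 : i%:R <= #|I :&: A|%:R :> R by rewrite ler_nat.
have h3 : s%:R * m%:R / n%:R <= r * s%:R / n%:R.
  by rewrite ler_pM2r ?invr_gt0 // mulrC ler_wpM2r ?ler0n.
lra.
Qed.

End OrderStatistics.

(** * Pointwise cost bounds outside the bad events *)

Section Costs.
Set Implicit Arguments. Unset Strict Implicit.
Variables (R : realType) (d : Order.disp_t) (T : orderType d) (n k : nat).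
Variables (X : 'I_n -> T).
Implicit Types (u v : T) (I : {set 'I_n}).

Let lt_card y := #|[set j | (X j < y)%O]|.
Let le_card y := #|[set j | (X j <= y)%O]|.

Lemma nhat_le_size u v : (nhat k X u v <= n)%N.
Proof.
rewrite /nhat; case: ifP => // _; case: ifP => _; first exact: card_set_ord_le.
by case: ifP => _; exact: card_set_ord_le.
Qed.

Lemma card_gtE y : #|[set j | (y < X j)%O]| = (n - le_card y)%N.
Proof.
have := cardsC [set j | (X j <= y)%O]; rewrite card_ord -/(le_card y).
have -> : ~: [set j | (X j <= y)%O] = [set j | (y < X j)%O].
  by apply/setP => j; rewrite !inE -ltNge.
by lia.
Qed.

(** [L] and [R] are bounded through the opposite pivot, because [lt_card v] and [le_card u] are the
    quantities that the bad events control. *)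
Lemma nhat_le u v : (u <= v)%O ->
  (nhat k X u v <= if (k <= lt_card u)%N then lt_card v
                   else if (le_card v < k)%N then n - le_card u
                   else lt_card v - le_card u)%N.
Proof.
move=> uv.
have luv : (lt_card u <= lt_card v)%N.
  by apply: subset_leq_card; apply/subsetP => j; rewrite !inE => /lt_le_trans; exact.
have euv : (le_card u <= le_card v)%N.
  by apply: subset_leq_card; apply/subsetP => j; rewrite !inE => /le_trans; exact.
have cM : (#|[set j | (u < X j)%O && (X j < v)%O]| <= lt_card v - le_card u)%N.
  have [{}uv|vu] := ltP u v; last first.
    rewrite (_ : [set _ | _] = set0) ?cards0 //; apply/setP => j; rewrite !inE.
    by apply/negP => /andP[/lt_trans h /h]; rewrite ltNge vu.
  rewrite (_ : [set _ | _] = [set j | (X j < v)%O] :\: [set j | (X j <= u)%O]); last first.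
    by apply/setP => j; rewrite !inE -ltNge.
  rewrite cardsD (setIidPr _) //; apply/subsetP => j; rewrite !inE => /le_lt_trans; exact.
have evn : (le_card v <= n)%N by exact: card_set_ord_le.
rewrite /nhat -/(lt_card u) card_gtE subKn //.
case: ifP => // _; case: ifP => // _; case: ifP => // _; lia.
Qed.

Lemma partition_cost_le I u v :
  (partition_cost k X I u v <=
   (n - #|I|) + if (2 * k < n)%N then lt_card v else n - le_card u)%N.
Proof.
rewrite /partition_cost leq_add2l; case: ifP => // _; case: ifP => _.
  by apply: subset_leq_card; apply/subsetP => j; rewrite !inE => /andP[].
rewrite -card_gtE.
by apply: subset_leq_card; apply/subsetP => j; rewrite !inE => /andP[].
Qed.

(** Coercing the bad events to 0 or 1 gives an inequality valid for every sample, to which [expect]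
    applies; the weight [n] covers the trivial bound. *)
Lemma partition_cost_bound I u v (W : R) : (k <= n)%N -> 0 <= W ->
  (partition_cost k X I u v)%:R <= n%:R - #|I|%:R + (minn k (n - k))%:R + 2 * W
    + n%:R * (((le_card u)%:R <= k%:R - 2 * W)%R%:R + (k%:R + 2 * W <= (lt_card v)%:R)%R%:R) :> R.
Proof.
move=> kn W0.
have := @partition_cost_le I u v.
set t := (if _ then _ else _) => h.
have hI := card_set_ord_le I.
have {}h : (partition_cost k X I u v)%:R <= n%:R - #|I|%:R + t%:R :> R.
  by rewrite -natrB // -natrD ler_nat.
apply: le_trans h _; rewrite -!addrA !lerD2l addrA.
have tn : t%:R <= n%:R :> R.
  by rewrite ler_nat /t; case: ifP => _; [exact: card_set_ord_le | exact: leq_subr].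
have m0 : 0 <= (minn k (n - k))%:R :> R by rewrite ler0n.
have n0 : 0 <= n%:R :> R by rewrite ler0n.
case: (boolP (_ <= k%:R - _)) => [_|]; case: (boolP (k%:R + _ <= _)) => [_|] /=;
  rewrite ?addr0 ?add0r ?mulr1 ?mulrDr ?mulr1; try lra.
rewrite -!ltNge => h1 h2; rewrite mulr0 addr0 /t.
case: ifP => k2.
  have -> : minn k (n - k) = k by lia.
  lra.
have -> : minn k (n - k) = (n - k)%N by lia.
rewrite !natrB //; [lra | exact: card_set_ord_le].
Qed.

(** Outside the four events, [M] has at most [(k + 2 W) - (k - 2 W)] elements. If the search goes to
    [L], then [k <= W] and [lt_card v < k + 2 W <= 3 W]; the case of [R] is symmetric. *)
Lemma nhat_bound u v (s : nat) (g W : R) : (u <= v)%O -> (0 < s)%N -> (0 < k <= n)%N ->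
    0 <= g -> W = g * n%:R / s%:R ->
  (nhat k X u v)%:R <= 4 * W
    + n%:R * (((k <= lt_card u)%N && (g < k%:R * s%:R / n%:R)%R)%:R
              + ((le_card u)%:R <= k%:R - 2 * W)%R%:R
              + ((le_card v < k)%N && (k%:R * s%:R / n%:R + g <= s%:R)%R)%:R
              + (k%:R + 2 * W <= (lt_card v)%:R)%R%:R) :> R.
Proof.
move=> uv s0 /andP[k0 kn] g0 WE.
have n0 : (0 < n)%N by exact: leq_trans kn.
have s0R : (0 : R) < s%:R by rewrite ltr0n.
have n0R : (0 : R) < n%:R by rewrite ltr0n.
have W0 : 0 <= W by rewrite WE !mulr_ge0 ?invr_ge0 ?ler0n.
(* Multiplying by [n / s] turns the index conditions on [g] into conditions on input ranks. *)
have kW : (g < k%:R * s%:R / n%:R) = (W < k%:R).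
  by rewrite WE ltr_pdivlMr // ltr_pdivrMr.
have nkW : (k%:R * s%:R / n%:R + g <= s%:R) = (W <= n%:R - k%:R).
  rewrite WE ler_pdivrMr // -lerBrDl -(ler_pM2r n0R) mulrBl divfK ?lt0r_neq0 //.
  by rewrite mulrBl [n%:R * _]mulrC.
rewrite kW nkW.
have hn : (nhat k X u v)%:R <= n%:R :> R by rewrite ler_nat nhat_le_size.
set a := _ && _; set b := _ <= k%:R - _; set c := _ && _; set e := k%:R + _ <= _.
suff good : ~~ [|| a, b, c | e] -> (nhat k X u v)%:R <= 4 * W.
  rewrite -!natrD; case: (boolP [|| a, b, c | e]) good => [bad _|_ good]; last first.
    by apply: le_trans (good isT) _; rewrite lerDl mulr_ge0 ?ler0n.
  apply: (le_trans hn); apply: ler_wpDl; first by rewrite mulr_ge0.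
  by rewrite ler_peMr ?ler0n // ler1n; move: bad; case: a; case: b; case: c; case: e.
rewrite !negb_or => /and4P[na nb nc ne].
move: nb ne; rewrite /b /e -!ltNge => hb he.
have := @nhat_le u v uv; move: na nc; rewrite /a /c.
have eu : (le_card u <= n)%N by exact: card_set_ord_le.
case: ifP => [_ /=|_ _].
  rewrite -leNgt => kW' _ h.
  have {}h : (nhat k X u v)%:R <= (lt_card v)%:R :> R by rewrite ler_nat.
  lra.
case: ifP => [_ /=|_ _].
  rewrite -ltNge => kW' h.
  have {}h : (nhat k X u v)%:R <= n%:R - (le_card u)%:R :> R.
    by rewrite -natrB // ler_nat.
  lra.
have [lv|lv] := leqP (lt_card v) (le_card u).
  rewrite (eqP (_ : _ - _ == 0)%N) ?subn_eq0 // leqn0 => /eqP ->.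
  by rewrite mulr_ge0.
move=> h; have {}h : (nhat k X u v)%:R <= (lt_card v)%:R - (le_card u)%:R :> R.
  by rewrite -natrB ?ler_nat // ltnW.
lra.
Qed.

End Costs.

(** * Sample indices of the pivots *)

Section Indices.
Set Implicit Arguments. Unset Strict Implicit.
Variables (R : realType) (n k s : nat) (g : R).
Hypotheses (s_gt0 : (0 < s)%N) (k_gt0 : (0 < k)%N) (le_kn : (k <= n)%N) (g_ge0 : 0 <= g).
Let q : R := k%:R * s%:R / n%:R.

Let n0R : (0 : R) < n%:R. Proof. by rewrite ltr0n (leq_trans k_gt0). Qed.
Let q0 : 0 < q. Proof. by rewrite divr_gt0 // mulr_gt0 // ltr0n. Qed.
Let qs : q <= s%:R.
Proof. by rewrite ler_pdivrMr // mulrC ler_wpM2l ?ler0n ?ler_nat. Qed.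

Lemma idx_uE : (idx_u n k s g)%:Z = Num.max (Num.ceil (q - g)) 1.
Proof. by rewrite abszE ger0_norm // le_max orbT. Qed.

Lemma idx_vE : (idx_v n k s g)%:Z = Num.min (Num.ceil (q + g)) s%:Z.
Proof. rewrite /idx_v -/q abszE ger0_norm // le_min ceil_ge0 andbT.
by rewrite (lt_le_trans (ltrN10 _)) // addr_ge0 // ltW.
Qed.

Lemma idx_u_gt0 : (0 < idx_u n k s g)%N.
Proof. by rewrite -ltz_nat idx_uE lt_max ltr01 orbT. Qed.

Lemma idx_u_le_v : (idx_u n k s g <= idx_v n k s g)%N.
Proof.
rewrite -lez_nat idx_uE idx_vE ge_max !le_min; apply/andP; split; apply/andP; split.
- by apply: le_ceil; rewrite lerD2l (le_trans _ g_ge0) // oppr_le0.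
- by rewrite ceil_le_int; apply: le_trans qs; rewrite gerBl.
- by rewrite -gtz0_ge1 ceil_gt0 ltr_wpDr.
- by rewrite lez_nat.
Qed.

Lemma idx_v_le : (idx_v n k s g <= s)%N.
Proof. by rewrite -lez_nat idx_vE ge_min lexx orbT. Qed.

Lemma idx_u_ge : q - g <= (idx_u n k s g)%:R.
Proof.
rewrite -[_%:R]/((idx_u n k s g)%:Z%:~R) idx_uE.
by apply: le_trans (ceil_ge _) _; rewrite ler_int le_max lexx.
Qed.

(** [g < q] makes the ceiling at least 1, so the clamp at 1 is inactive. In [idx_v_ge] the
    assumption does the same for the clamp at [s]. *)
Lemma idx_u_lt : g < q -> (idx_u n k s g)%:R - 1 <= q - g.
Proof.
move=> gq; rewrite -[_%:R]/((idx_u n k s g)%:Z%:~R) idx_uE.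
have c1 : 1 <= Num.ceil (q - g) by rewrite -gtz0_ge1 ceil_gt0 subr_gt0.
by rewrite (max_idPl c1); have := ceilB1_lt (q - g); rewrite intrB => /ltW.
Qed.

Lemma idx_v_ge : q + g <= s%:R -> q + g <= (idx_v n k s g)%:R.
Proof.
move=> qgs; rewrite -[X in _ <= X]/((idx_v n k s g)%:Z%:~R) idx_vE.
have cs : Num.ceil (q + g) <= s%:Z by rewrite ceil_le_int.
by rewrite (min_idPl cs) ceil_ge.
Qed.

Lemma idx_v_lt : (idx_v n k s g)%:R - 1 <= q + g.
Proof.
rewrite -[_%:R]/((idx_v n k s g)%:Z%:~R) idx_vE.
apply: le_trans (ltW (ceilB1_lt (q + g))).
by rewrite intrB lerD2r ler_int ge_min lexx.
Qed.

End Indices.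

(** * Sample size and gap as powers of [n] *)

Section SampleAndGap.
Set Implicit Arguments. Unset Strict Implicit.
Variables (R : realType) (alpha beta eps eps_s : R) (n : nat).
Hypothesis alpha_gt0 : 0 < alpha.
Hypothesis s_lt : (sample_size alpha eps_s n < n.-1)%N.
Let s := sample_size alpha eps_s n.
Let g := gap beta eps n s.

Let n_gt0 : (0 < n)%N. Proof. by case: n s_lt. Qed.
Let n0R : 0 < n%:R :> R. Proof. by rewrite ltr0n. Qed.
Let n1R : 1 <= n%:R :> R. Proof. by rewrite ler1n. Qed.

(** [s < n - 1] forces the minimum in [sample_size] to be the ceiling. *)
Lemma sample_sizeE : s%:R = (Num.ceil (alpha * n%:R `^ eps_s))%:~R :> R.
Proof.
have c0 : 0 <= Num.ceil (alpha * n%:R `^ eps_s).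
  by rewrite ceil_ge0 (lt_le_trans (ltrN10 _)) // mulr_ge0 ?powR_ge0 // ltW.
rewrite -[in RHS](ger0_norm c0) -natr_absz; congr (_%:R).
by move: s_lt; rewrite /s /sample_size; lia.
Qed.

Lemma sample_size_ge : alpha * n%:R `^ eps_s <= s%:R.
Proof. by rewrite sample_sizeE ceil_ge. Qed.

Lemma sample_size_le : s%:R <= alpha * n%:R `^ eps_s + 1.
Proof.
rewrite sample_sizeE -lerBlDr; have := ceilB1_lt (alpha * n%:R `^ eps_s).
by rewrite intrB => /ltW.
Qed.

Lemma sample_size_gt0 : (0 < s)%N.
Proof.
rewrite -(ltr0n R); apply: lt_le_trans sample_size_ge.
by rewrite mulr_gt0 // powR_gt0.
Qed.

Hypothesis beta_gt0 : 0 < beta.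

Lemma gap_sqr : g ^+ 2 = beta * s%:R * n%:R `^ eps.
Proof. by rewrite sqr_sqrtr // !mulr_ge0 ?powR_ge0 // ltW. Qed.

Lemma gap_exponent : 2 * g ^+ 2 / s%:R = 2 * beta * n%:R `^ eps.
Proof.
rewrite gap_sqr; have : s%:R != 0 :> R by rewrite pnatr_eq0 -lt0n sample_size_gt0.
by move=> ?; field.
Qed.

(** The left side is [n * sqrt (beta * n^eps / s)]. Inserting [s >= alpha * n^eps_s] yields the
    exponent [1 + (eps - eps_s) / 2], which is at most eta. *)
Lemma gap_width_le :
  g * n%:R / s%:R <= Num.sqrt (beta / alpha) * n%:R `^ eta_of eps eps_s.
Proof.
have s0 : 0 < s%:R :> R by rewrite ltr0n sample_size_gt0.
have g0 : 0 <= g by rewrite sqrtr_ge0.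
apply: (@le_trans _ _ (Num.sqrt (beta / alpha) * n%:R `^ (1 + (eps - eps_s) / 2))); last first.
  by rewrite ler_wpM2l ?sqrtr_ge0 // ler_powR // /eta_of le_max lexx.
rewrite -(@ler_pXn2r _ 2) ?nnegrE ?mulr_ge0 ?invr_ge0 ?sqrtr_ge0 ?powR_ge0 ?ler0n //.
rewrite [X in _ <= X]exprMn sqr_sqrtr; last by rewrite divr_ge0 // ltW.
have -> : (n%:R `^ (1 + (eps - eps_s) / 2)) ^+ 2 = n%:R ^+ 2 * n%:R `^ eps / n%:R `^ eps_s.
  rewrite -powR_mulrn ?powR_ge0 // -powRrM.
  rewrite -[n%:R ^+ 2]powR_mulrn ?ler0n // -powRN -!powRD ?(lt0r_neq0 n0R) ?implybT //.
  by congr (_ `^ _); field.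
rewrite !exprMn gap_sqr.
have ge := sample_size_ge; move: ge; set a := n%:R `^ eps_s; set e := n%:R `^ eps => ge.
have a0 : 0 < a by exact: powR_gt0.
have e0 : 0 < e by exact: powR_gt0.
have -> : beta * s%:R * e * n%:R ^+ 2 * s%:R^-1 ^+ 2 = beta * e * n%:R ^+ 2 * s%:R^-1.
  by have := lt0r_neq0 s0 => ?; field.
have -> : beta / alpha * (n%:R ^+ 2 * e / a) = beta * e * n%:R ^+ 2 * (alpha * a)^-1.
  by have := lt0r_neq0 a0; have := lt0r_neq0 alpha_gt0 => ? ?; field; apply/andP.
apply: ler_wpM2l; first by rewrite !mulr_ge0 ?sqr_ge0 // ltW.
by rewrite lef_pV2 ?posrE // mulr_gt0.
Qed.

End SampleAndGap.

(** * Combining the bounds: tail and expectation of [cnk] *)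

Theorem theorem5p1 (R : realType) (d : Order.disp_t) (T : orderType d)
    (alpha beta gammaP eps eps_s : R)
    (halpha : 0 < alpha) (hbeta : 0 < beta) (hgamma : 2 < gammaP)
    (heps : 0 < eps) (heps_s : eps < eps_s)
    (heta : eta_of eps eps_s < 1)
    (n k : nat) (hk1 : (1 <= k)%N) (hkn : (k <= n)%N)
    (hs : (sample_size alpha eps_s n < n.-1)%N)
    (X : 'I_n -> T) (x0 : T) (cnk : {set 'I_n} -> nat) :
  let eta := eta_of eps eps_s in
  let s := sample_size alpha eps_s n in
  let g := gap beta eps n s in
  let u := fun I => order_stat x0 X I (idx_u n k s g) in
  let v := fun I => order_stat x0 X I (idx_v n k s g) in
  let ghat := (4 * gammaP + 2) * Num.sqrt (beta / alpha)
              + (2 * gammaP - 1) * (alpha + 1 / n%:R `^ eta) in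
  (* c_nk <= 2 gammaP s + c + gammaP hat n, for every sample I *)
  (forall I : {set 'I_n}, #|I| = s ->
     (cnk I)%:R <= 2 * gammaP * s%:R
                   + (partition_cost k X I (u I) (v I))%:R
                   + gammaP * (nhat k X (u I) (v I))%:R) ->
  prob R s (fun I => (cnk I)%:R <= n%:R + (minn k (n - k))%:R + ghat * n%:R `^ eta)
    >= 1 - 4 * expR (- (2 * beta * n%:R `^ eps))
  /\
  (n%:R `^ (1 - eta) * expR (- (2 * beta * n%:R `^ eps)) <= 1 ->
   expect s (fun I => (cnk I)%:R)
     <= n%:R + (minn k (n - k))%:R + (ghat + 4 * gammaP + 2) * n%:R `^ eta).
Proof.
move=> eta s g u v ghat hc.
have s0 : (0 < s)%N by exact: sample_size_gt0.
have sn : (s <= n)%N by rewrite (leq_trans (ltnW hs)) // leq_pred.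
have s0R : 0 < s%:R :> R by rewrite ltr0n.
have n0 : (0 < n)%N by exact: leq_trans hkn.
have n0R : 0 < n%:R :> R by rewrite ltr0n.
have g0 : 0 <= g by rewrite sqrtr_ge0.
have iu0 := idx_u_gt0 n k s g.
have iuv := idx_u_le_v s0 hk1 hkn g0.
have ivs : (idx_v n k s g <= s)%N by exact: idx_v_le.
have iu_rng : (0 < idx_u n k s g <= s)%N by rewrite iu0 (leq_trans iuv).
have iv_rng : (0 < idx_v n k s g <= s)%N by rewrite (leq_trans iu0).
pose W := g * n%:R / s%:R.
have W0 : 0 <= W by rewrite !mulr_ge0 ?invr_ge0 ?ler0n.
have WE : W * s%:R / n%:R = g.
  by rewrite /W; have := lt0r_neq0 n0R; have := lt0r_neq0 s0R => ? ?; field; apply/andP.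
set q := k%:R * s%:R / n%:R : R.
set e := expR _.
have eE : e = expR (- (2 * g ^+ 2 / s%:R)) by rewrite gap_exponent.
have e0 : 0 <= e by exact: expR_ge0.
(* If [q <= g], then [k <= W] and even [L], whose size is at most [#|{x < v}|],
   has fewer than [3 W] elements; so the test [g < q] can be part of [u_high].
   Symmetrically for [v_low] and [R]. *)
pose u_high (I : {set 'I_n}) := (k <= #|[set j | (X j < u I)%O]|)%N && (g < q).
pose u_low (I : {set 'I_n}) := #|[set j | (X j <= u I)%O]|%:R <= k%:R - 2 * W.
pose v_low (I : {set 'I_n}) := (#|[set j | (X j <= v I)%O]| < k)%N && (q + g <= s%:R).
pose v_high (I : {set 'I_n}) := k%:R + 2 * W <= #|[set j | (X j < v I)%O]|%:R.
have pa : prob R s u_high <= e.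
  have [gq|gq] := ltP g q; last first.
    by rewrite prob_false // => I; rewrite /u_high ltNge gq andbF.
  rewrite eE; apply: le_trans (@prob_order_stat_high R _ T n X x0 s _ k%:R g iu_rng sn g0 _).
    by apply: ler_prob => I _ /andP[h _]; rewrite ler_nat.
  exact: idx_u_lt.
(* In sample ranks the threshold [k - 2 W] is [q - 2 g], while the index of [u] is at least [q - g]:
   a deviation of [g] remains. *)
have pb : prob R s u_low <= e.
  rewrite eE; apply: (@prob_order_stat_low R _ T n X x0 s _ _ g iu_rng sn g0 _).
  have -> : (k%:R - 2 * W) * s%:R / n%:R = q - 2 * g.
    by rewrite -WE /q; ring.
  by have := idx_u_ge n k s g; rewrite -/q; lra.
have pc : prob R s v_low <= e.
  have [gq|gq] := leP (q + g) s%:R; last first.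
    by rewrite prob_false // => I; rewrite /v_low leNgt gq andbF.
  rewrite eE; apply: le_trans (@prob_order_stat_low R _ T n X x0 s _ k%:R g iv_rng sn g0 _).
    by apply: ler_prob => I _ /andP[h _]; rewrite ler_nat ltnW.
  exact: idx_v_ge.
(* The index of [v] may reach [q + g + 1] by rounding up; the strict count in [order_stat_card_lt]
   absorbs the 1. *)
have pd : prob R s v_high <= e.
  rewrite eE; apply: (@prob_order_stat_high R _ T n X x0 s _ _ g iv_rng sn g0 _).
  have -> : (k%:R + 2 * W) * s%:R / n%:R = q + 2 * g.
    by rewrite -WE /q; ring.
  by have := @idx_v_lt R n k s g s0 hk1 hkn g0; rewrite -/q; lra.
pose f := n%:R `^ eta.
have f0 : 0 < f by exact: powR_gt0.
pose B := n%:R + (minn k (n - k))%:R + ghat * f.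
(* The first term pays for [2 W] in partitioning and [4 W] in the final search. The second pays for
   [2 gammaP s] in pivot selection minus the [s] sample elements that partitioning skips. *)
have gf : ghat * f = (4 * gammaP + 2) * (Num.sqrt (beta / alpha) * f)
    + (2 * gammaP - 1) * (alpha * f + 1).
  by rewrite /ghat -/f; have := lt0r_neq0 f0 => ?; field.
have WB : (4 * gammaP + 2) * W <= (4 * gammaP + 2) * (Num.sqrt (beta / alpha) * f).
  by rewrite ler_wpM2l ?gap_width_le //; lra.
have sB : (2 * gammaP - 1) * s%:R <= (2 * gammaP - 1) * (alpha * f + 1).
  apply: ler_wpM2l; first lra.
  apply: (le_trans (sample_size_le halpha hs)).
  by rewrite lerD2r ler_pM2l // ler_powR ?ler1n // /eta /eta_of le_max lexx orbT.
(* Only a misplaced [u] or [v] ([u_low], [v_high]) inflates the partitioning cost,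
   whence the constant [4 gammaP + 2] of the expectation bound. *)
have cost (I : {set 'I_n}) : #|I| = s ->
    (cnk I)%:R <= B + n%:R * ((u_low I)%:R + (v_high I)%:R)
      + gammaP * (n%:R * ((u_high I)%:R + (u_low I)%:R + (v_low I)%:R + (v_high I)%:R)).
  move=> cI.
  have uv : (u I <= v I)%O by apply: order_stat_le => //; rewrite iuv cI.
  have h1 := @partition_cost_bound R _ T n k X I (u I) (v I) W hkn W0.
  have h2 := @nhat_bound R _ T n k X (u I) (v I) s g W uv s0 (introT andP (conj hk1 hkn)) g0 erefl.
  rewrite cI in h1; rewrite -/(u_low I) -/(v_high I) in h1.
  rewrite -/q -/(u_high I) -/(u_low I) -/(v_low I) -/(v_high I) in h2.
  have := hc I cI; move: h1 h2.
  set bd := n%:R * (_ + _); set abcd := n%:R * (_ + _).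
  move: (partition_cost _ _ _ _ _)%:R (nhat _ _ _ _)%:R => pcost nh h1 h2 h3.
  have h4 : gammaP * nh <= gammaP * (4 * W + abcd) by rewrite ler_wpM2l //; lra.
  by rewrite /B gf; lra.
split.
  (* Union bound: for each sample, the cost bound holds or one of the four indicators is 1. *)
  have pg : 1 <= prob R s (fun I => (cnk I)%:R <= B)
      + (prob R s u_high + prob R s u_low + prob R s v_low + prob R s v_high).
    rewrite !prob_expect -!expectD -[X in X <= _](@expect_cst R n s 1 sn).
    apply: ler_expect => I cI; have := cost I cI; rewrite -!natrD ler1n.
    case: (u_high I); case: (u_low I); case: (v_low I); case: (v_high I);
      rewrite ?addn_gt0 ?orbT //=.
    by rewrite mulr0n !mulr0 !addr0 => ->.
  by rewrite -/B; lra.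
move=> hne.
have nef : n%:R * e <= f.
  have -> : n%:R = f * n%:R `^ (1 - eta) :> R.
    by rewrite -powRD ?(lt0r_neq0 n0R) ?implybT // addrC subrK powRr1 // ltW.
  by rewrite -mulrA ler_piMr // ltW.
have : expect s (fun I => (cnk I)%:R) <= B + n%:R * (prob R s u_low + prob R s v_high)
    + gammaP * (n%:R * (prob R s u_high + prob R s u_low + prob R s v_low + prob R s v_high)).
  rewrite !prob_expect -!expectD -!expectZ -{1}(@expect_cst R n s B sn) -!expectD.
  exact: ler_expect.
move=> /le_trans; apply.
have h1 : n%:R * (prob R s u_low + prob R s v_high) <= 2 * f.
  apply: (@le_trans _ _ (n%:R * (2 * e))); last by lra.
  by rewrite ler_pM2l //; lra.
have h2 : gammaP * (n%:R * (prob R s u_high + prob R s u_low + prob R s v_low + prob R s v_high))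
    <= gammaP * (4 * f).
  rewrite ler_pM2l; last lra.
  apply: (@le_trans _ _ (n%:R * (4 * e))); last by lra.
  by rewrite ler_pM2l //; lra.
by rewrite /B -/f; lra.
Qed.
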